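(* Let $K$ be a finite $k$-dimensional simplicial complex with $k\ge1$, and let $D$ be the maximum upper degree of a ridge of $K$. Suppose that $\Gamma(K)$ is connected and that $K$ is disorientable in dimension $k$. Then $\lambda_1(L^{\mathrm{up}}_{k-1}(K))=D+k$ if and only if all $k$-faces of $K$ contain one common ridge.
   Context: A simplicial complex $K$ on a finite vertex set is a collection of subsets closed under taking subsets; a face with $m+1$ vertices has dimension $m$, and $K_j$ is the set of $j$-dimensional faces; $K$ is $k$-dimensional if $k$ is the largest dimension of a face. The $k$-faces are called facets and the $(k-1)$-faces ridges. The upper degree of a ridge $\rho$ is $d(\rho)=|\{F\in K_k:\rho\subset F\}|$. Choose an orientation (an ordering of the vertices, up to even permutations) of each face. The boundary matrix $B_k=([\sigma:F])_{\sigma\in K_{k-1},F\in K_k}$ has $[\sigma:F]=0$ if $\sigma\not\subset F$, and if $F=[v_0,\dots,v_k]$ and $\sigma=F\setminus\{v_i\}$ then $[\sigma:F]=(-1)^i\operatorname{sgn}(\pi)$, where $\pi$ is the permutation carrying $(v_0,\dots,\widehat{v_i},\dots,v_k)$ to the chosen ordering of $\sigma$. The up-Laplacian is $L^{\mathrm{up}}_{k-1}(K)=B_kB_k^{\mathsf T}$, and $\lambda_1$ denotes the largest eigenvalue. Two distinct facets are adjacent if they share a ridge; $\Gamma(K)$ is the graph on $K_k$ with these adjacencies. $K$ is disorientable in dimension $k$ if the $k$-simplices can be oriented so that any two adjacent $k$-simplices $F,G$ induce the same incidence sign on their common ridge $R$, i.e. $[R:F]=[R:G]$. *)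

(* Defs.v *)
From mathcomp Require Import all_boot all_order all_fingroup all_algebra.
From mathcomp Require Import reals.

Set Implicit Arguments.
Unset Strict Implicit.
Unset Printing Implicit Defensive.

Import Order.TTheory GRing.Theory Num.Theory.
Local Open Scope ring_scope.

(* The empty face (dimension -1) is allowed, and an element of V need not be
   a vertex of K. *)
Definition simplicial_complex (V : finType) (K : {set {set V}}) : Prop :=
  forall F G : {set V}, F \in K -> G \subset F -> G \in K.

Definition faces (V : finType) (K : {set {set V}}) (m : nat) : {set {set V}} :=
  [set F in K | #|F| == m.+1].

Definition has_dimension (V : finType) (K : {set {set V}}) (k : nat) : Prop :=
  faces K k != set0 /\ (forall m, faces K m != set0 -> (m <= k)%N).

(* Meant for k >= 1 only: k.-1 is truncated. *)
Definition ridges (V : finType) (K : {set {set V}}) (k : nat) : {set {set V}} :=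
  faces K k.-1.

Definition upper_degree (V : finType) (K : {set {set V}}) (k : nat)
    (r : {set V}) : nat :=
  #|[set F in faces K k | r \subset F]|.

Definition max_upper_degree (V : finType) (K : {set {set V}}) (k : nat) : nat :=
  (\max_(r in ridges K k) upper_degree K k r)%N.

(* An orientation of a face is given by an ordering of its vertices
   representing it; incidence numbers only depend on the class of the orderings
   up to even permutations. *)
Definition orientation_of (V : finType) (A : {set {set V}})
    (o : {set V} -> seq V) : Prop :=
  forall F : {set V}, F \in A -> perm_eq (o F) (enum F).

(* Signature of the permutation carrying s to t. It is unique when s is
   duplicate-free; the value is 0 if t is not a rearrangement of s. *)
Definition sgn_reorder (V : eqType) (s t : seq V) : int :=
  if [pick p : 'S_(size s) |
        t == [tuple tnth (in_tuple s) (p i) | i < size s] :> seq V] is Some p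
  then (-1) ^+ (odd_perm p) else 0.

(* [sigma : F], where sigma and F carry the orientations given by the
   orderings s and t. *)
Definition incidence (V : finType) (sigma F : {set V}) (s t : seq V) : int :=
  if [pick v in F | sigma == F :\ v] is Some v
  then (-1) ^+ (index v t) * sgn_reorder (rem v t) s else 0.

Definition boundary_mx (R : realType) (V : finType) (K : {set {set V}})
    (k : nat) (o : {set V} -> seq V) : 'M[R]_(#|ridges K k|, #|faces K k|) :=
  \matrix_(i, j) (incidence (enum_val i) (enum_val j)
                            (o (enum_val i)) (o (enum_val j)))%:~R.

Definition up_laplacian (R : realType) (V : finType) (K : {set {set V}})
    (k : nat) (o : {set V} -> seq V) : 'M[R]_#|ridges K k| :=
  boundary_mx R K k o *m (boundary_mx R K k o)^T.

(* [eigenvalue] uses row eigenvectors, which makes no difference for the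
   symmetric matrix [up_laplacian]. *)
Definition largest_eigenvalue (R : realType) (n : nat) (A : 'M[R]_n)
    (a : R) : Prop :=
  eigenvalue A a /\ (forall b : R, eigenvalue A b -> b <= a).

Definition facet_adj (V : finType) (K : {set {set V}}) (k : nat) :
    rel {set V} :=
  fun F G => [&& F \in faces K k, G \in faces K k, F != G &
    [exists r in ridges K k, (r \subset F) && (r \subset G)]].

Definition facet_graph_connected (V : finType) (K : {set {set V}})
    (k : nat) : Prop :=
  forall F G : {set V}, F \in faces K k -> G \in faces K k ->
    connect (facet_adj K k) F G.

(* Only the k-faces are reoriented, by o'; ridges keep the orientation o. The
   property does not depend on o: reversing a ridge changes the two incidence
   numbers that are compared by the same sign. *)
Definition disorientable (V : finType) (K : {set {set V}}) (k : nat)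
    (o : {set V} -> seq V) : Prop :=
  exists2 o' : {set V} -> seq V, orientation_of (faces K k) o' &
    forall F G r : {set V}, facet_adj K k F G -> r \in ridges K k ->
      r \subset F -> r \subset G ->
      incidence r F (o r) (o' F) = incidence r G (o r) (o' G).

(* Main.v *)
(** For a disorientation, the Gram matrix of the columns of the boundary matrix
    is [C F G = #|{ridges contained in F and G}|], which equals [(k+1) I] plus
    the adjacency matrix of the facet graph, and it has the same nonzero
    eigenvalues as the up-Laplacian. If all facets share a ridge then [D] is
    the number of facets, [C = k I + J], and the top eigenvalue is [D + k].
    Conversely, the facets containing a ridge of maximal degree form a clique,
    whose indicator vector has Rayleigh quotient [D + k]; if there are other
    facets, connectivity provides one adjacent to the clique, and giving it a
    small positive weight makes the Rayleigh quotient exceed [D + k]. *)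
Require Import Defs.
From mathcomp Require Import all_boot all_order all_fingroup all_algebra.
From mathcomp Require Import reals complex spectral sesquilinear.
From mathcomp Require Import lra.
Set Implicit Arguments.
Unset Strict Implicit.
Unset Printing Implicit Defensive.
Import Order.TTheory GRing.Theory Num.Theory.
Local Open Scope ring_scope.

(** * Signs of reorderings of vertex lists *)

(** As [s] has no duplicates, positions determine the permutation, so the [pick] in [sgn_reorder]
    can only return [p]. *)
Lemma sgn_reorderE (V : eqType) n (p : 'S_n) (s t : seq V) x0 :
  size s = n -> size t = n -> uniq s ->
  (forall i : 'I_n, nth x0 t i = nth x0 s (p i)) ->
  sgn_reorder s t = (-1) ^+ p.
Proof.
move=> sz_s; subst n => sz_t s_uniq nth_t; rewrite /sgn_reorder.
have tP (q : 'S_(size s)) :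
    (t == [tuple tnth (in_tuple s) (q i) | i < size s]) = (q == p).
  apply/eqP/eqP => [tq|->].
    apply/permP => i; apply/val_inj/eqP.
    rewrite -(nth_uniq x0 (ltn_ord _) (ltn_ord _) s_uniq).
    by rewrite -nth_t tq -tnth_nth tnth_mktuple (tnth_nth x0).
  apply: (@eq_from_nth _ x0) => [|i]; rewrite ?size_tuple // sz_t => lt_i.
  rewrite (nth_t (Ordinal lt_i)) -(tnth_nth x0 _ (Ordinal lt_i)) tnth_mktuple.
  by rewrite (tnth_nth x0).
by case: pickP => [q|/(_ p)]; rewrite tP ?eqxx // => /eqP->.
Qed.

Lemma perm_eq_nth (V : eqType) n (s t : seq V) x0 :
  size s = n -> perm_eq t s ->
  exists p : 'S_n, forall i : 'I_n, nth x0 t i = nth x0 s (p i).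
Proof.
move=> sz_s; subst n => /(@tuple_permP _ _ _ (in_tuple s))[p tE].
exists p => i.
by rewrite tE -tnth_nth tnth_mktuple (tnth_nth x0).
Qed.

(** The empty list offers no element to serve as the default of [nth], hence this separate case. *)
Lemma sgn_reorder_nil (V : eqType) : @sgn_reorder V [::] [::] = 1.
Proof.
rewrite /sgn_reorder; case: pickP => [p _|/(_ 1%g)/negP[]].
  suff -> : p = 1%g by rewrite odd_perm1.
  by apply/permP => -[].
by apply/eqP/esym/size0nil; rewrite size_tuple.
Qed.

(** If [p] carries [s] to [t] and [q] carries [t] to [u], then [q * p] carries [s] to [u], and the
    sign is a morphism. *)
Lemma sgn_reorderM (V : eqType) (s t u : seq V) :
  uniq s -> perm_eq t s -> perm_eq u t ->
  sgn_reorder s u = sgn_reorder s t * sgn_reorder t u.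
Proof.
case: s => [|x0 s0].
  by move=> _ /perm_nilP -> /perm_nilP ->; rewrite sgn_reorder_nil mulr1.
set s := x0 :: s0 => s_uniq ts ut.
have [p pE] := perm_eq_nth x0 (erefl (size s)) ts.
have [q qE] := perm_eq_nth x0 (perm_size ts) ut.
have t_uniq : uniq t by rewrite (perm_uniq ts).
rewrite (sgn_reorderE (perm_size ts) _ t_uniq qE); last first.
  by rewrite (perm_size ut) (perm_size ts).
rewrite (sgn_reorderE (erefl _) (perm_size ts) s_uniq pE).
have pqE (i : 'I_(size s)) : nth x0 u i = nth x0 s ((q * p)%g i).
  by rewrite qE pE permM.
rewrite (sgn_reorderE (erefl _) _ s_uniq pqE); last first.
  by rewrite (perm_size ut) (perm_size ts).
by rewrite odd_permM signr_addb mulrC.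
Qed.

Lemma sgn_reorder_sqr (V : eqType) (s t : seq V) :
  uniq s -> perm_eq t s -> sgn_reorder s t ^+ 2 = 1.
Proof.
case: s => [|x0 s0].
  by move=> _ /perm_nilP ->; rewrite sgn_reorder_nil expr1n.
set s := x0 :: s0 => s_uniq ts.
have [p pE] := perm_eq_nth x0 (erefl (size s)) ts.
rewrite (sgn_reorderE (erefl _) (perm_size ts) s_uniq pE).
by rewrite -exprM mulnC exprM sqrrN !expr1n.
Qed.

Lemma nth_rem_bump (V : eqType) (x0 v : V) (t : seq V) i :
  nth x0 (rem v t) i = nth x0 t (bump (index v t) i).
Proof.
elim: t i => [|y t IH] i; first by rewrite !nth_nil.
rewrite /= /bump; case: eqVneq => //= _.
by case: i => [|i] //=; rewrite IH /bump ltnS addnS.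
Qed.

(* Placing [v] in front absorbs the factor [(-1) ^+ index v t]: an incidence
   number is the sign of a reordering of the whole facet, hence multiplicative
   under reorientation of the facet. *)
Lemma sgn_reorder_rem (V : eqType) (v : V) (s t : seq V) :
  uniq t -> v \in t -> perm_eq s (rem v t) ->
  sgn_reorder t (v :: s) = (-1) ^+ index v t * sgn_reorder (rem v t) s.
Proof.
move=> t_uniq vt sr; pose n := size (rem v t).
have [p pE] := perm_eq_nth v (erefl n) sr.
have szt : size t = n.+1.
  by rewrite /n size_rem // prednK //; case: (t) vt.
have lt_i : (index v t < n.+1)%N by rewrite -szt index_mem.
rewrite (sgn_reorderE (erefl n) (perm_size sr) (rem_uniq _ t_uniq) pE).
(* The lifted permutation sends 0 to the position of [v] in [t] and acts as [p] on the remaining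
   positions; its parity is that of [index v t] plus that of [p]. *)
rewrite (@sgn_reorderE _ n.+1 (lift_perm ord0 (Ordinal lt_i) p) _ _ v) //=.
- by rewrite odd_lift_perm /= signr_addb signr_odd.
- by rewrite (perm_size sr).
move=> i; case: (unliftP ord0 i) => [j|] -> /=.
  by rewrite lift_perm_lift pE nth_rem_bump.
by rewrite lift_perm_id /= nth_index.
Qed.

(** * Incidence numbers under change of orientation *)

Lemma incidence_notsub (V : finType) (r F : {set V}) s t :
  ~~ (r \subset F) -> incidence r F s t = 0.
Proof.
move=> nrF; rewrite /incidence; case: pickP => // v /andP[_ /eqP rE].
by rewrite rE subD1set in nrF.
Qed.

Lemma card_subset_setD1 (V : finType) (r F : {set V}) k :
  #|r| = k -> #|F| = k.+1 -> r \subset F -> exists2 v, v \in F & r = F :\ v.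
Proof.
move=> cr cF rF; have /cards1P[v FDr] : #|F :\: r| == 1%N.
  by rewrite cardsD (setIidPr rF) cF cr subSnn.
have : v \in F :\: r by rewrite FDr set11.
rewrite inE => /andP[vr vF]; exists v => //.
by rewrite -FDr setDDr setDv set0U (setIidPr rF).
Qed.

Lemma incidenceE (V : finType) (F : {set V}) v s t :
  v \in F -> perm_eq t (enum F) -> incidence (F :\ v) F s t =
    (-1) ^+ index v t * sgn_reorder (rem v t) s.
Proof.
move=> vF tF; rewrite /incidence; case: pickP => [w /andP[wF /eqP vw]|/(_ v)].
  have -> // : w = v; apply/eqP; apply: contraT => nwv.
  by have := setD11 w F; rewrite -vw in_setD1 wF nwv.
by rewrite vF eqxx.
Qed.

Lemma perm_rem_enum (V : finType) (F : {set V}) v s t :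
  perm_eq t (enum F) -> perm_eq s (enum (F :\ v)) -> perm_eq s (rem v t).
Proof.
move=> tF sF; have t_uniq : uniq t by rewrite (perm_uniq tF) enum_uniq.
apply: uniq_perm; rewrite ?rem_uniq // ?(perm_uniq sF) ?enum_uniq // => x.
rewrite (perm_mem sF) mem_enum in_setD1 rem_filter // mem_filter /=.
by rewrite (perm_mem tF) mem_enum.
Qed.

Lemma incidence_sqr (V : finType) (r F : {set V}) k s t :
  #|r| = k -> #|F| = k.+1 -> r \subset F ->
  perm_eq s (enum r) -> perm_eq t (enum F) -> incidence r F s t ^+ 2 = 1.
Proof.
move=> cr cF rF + tF; have [v vF ->] := card_subset_setD1 cr cF rF => sr.
rewrite incidenceE // exprMn -exprM mulnC exprM sqrrN !expr1n mul1r.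
apply: sgn_reorder_sqr; last exact: perm_rem_enum tF sr.
by rewrite rem_uniq // (perm_uniq tF) enum_uniq.
Qed.

Lemma incidence_reorder (V : finType) (r F : {set V}) k s t t' :
  #|r| = k -> #|F| = k.+1 ->
  perm_eq s (enum r) -> perm_eq t (enum F) -> perm_eq t' (enum F) ->
  incidence r F s t' = sgn_reorder t' t * incidence r F s t.
Proof.
move=> cr cF + tF t'F; have [rF|nrF] := boolP (r \subset F); last first.
  by rewrite !incidence_notsub // mulr0.
have [v vF ->] := card_subset_setD1 cr cF rF => sr.
have u u' : perm_eq u' (enum F) -> uniq u'.
  by move/perm_uniq->; apply: enum_uniq.
have vin u' : perm_eq u' (enum F) -> v \in u'.
  by move/perm_mem->; rewrite mem_enum.
(* Both incidence numbers are now signs of reorderings into [v :: s], so the multiplicativity of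
   signs compares them. *)
rewrite !incidenceE // -!sgn_reorder_rem ?(perm_rem_enum _ sr) ?u ?vin //.
apply: sgn_reorderM; rewrite ?u //; first by rewrite (permPl tF) perm_sym.
rewrite perm_sym (permPl (perm_to_rem (vin _ tF))) perm_cons perm_sym.
exact: perm_rem_enum sr.
Qed.

(** * Eigenvalues of products and the Rayleigh bound *)

(** An eigenvector [x] of [A *m B] yields [x *m A] for [B *m A]; if that vanished, so would
    [b *: x]. *)
Lemma eigenvalue_mulmxC (F : fieldType) m n (A : 'M[F]_(m, n))
    (B : 'M[F]_(n, m)) b :
  b != 0 -> eigenvalue (A *m B) b -> eigenvalue (B *m A) b.
Proof.
move=> b0 /eigenvalueP[x xAB x0]; apply/eigenvalueP; exists (x *m A).
  by rewrite mulmxA -(mulmxA x) xAB scalemxAl.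
apply: contra_neq x0 => xA0; move: xAB; rewrite mulmxA xA0 mul0mx => /esym/eqP.
by rewrite scaler_eq0 (negPf b0) => /eqP.
Qed.

Section Rayleigh.
Local Open Scope sesquilinear_scope.

(** Over [R[i]] a unitary [P] diagonalises the matrix, and the quadratic form becomes a sum of
    squared moduli weighted by the eigenvalues. *)
Lemma rayleigh_le (R : rcfType) n (A : 'M[R]_n) (a : R) (y : 'rV[R]_n) :
  A^T = A -> (forall b, eigenvalue A b -> b <= a) ->
  (y *m A *m y^T) 0 0 <= a * (y *m y^T) 0 0.
Proof.
move=> symA leA.
pose f : {rmorphism R -> R[i]} := real_complex R.
pose Ac := map_mx f A; pose yc := map_mx f y.
have freal x : f x \is Num.real by apply/complex_realP; exists x.
have realA : Ac \is a mxOver Num.real by apply/mxOverP => i j; rewrite mxE.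
have hermA : Ac \is hermsymmx.
  apply: realsym_hermsym => //; apply/is_hermitianmxP.
  by rewrite expr0 scale1r map_mx_id // map_trmx symA.
have := hermitian_spectral_diag_real hermA.
have /hermitian_normalmx/orthomx_spectralP := hermA.
set P := spectralmx _; set d := spectral_diag _ => AP /mxOverP dR.
have uP : P \is unitarymx by exact: spectral_unitarymx.
have Pu : P \in unitmx by exact: spectral_unit.
(* Each diagonal entry is real, hence the image of some [b] in [R]; row [i] of [P] is an eigenvector
   for it, so [b] is an eigenvalue of [A] itself. *)
have led i : d 0 i <= f a.
  have /complex_realP[b db] := dR 0 i.
  rewrite db lecR; apply: leA; rewrite -(eigenvalue_map f).
  apply/eigenvalueP; exists (row i P).
    rewrite -/Ac AP !rowE -!mulmxA (mulKVmx Pu) mulmxA.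
    rewrite -[X in X *m P = _]rowE row_diag_mx -scalemxAl.
    by rewrite db.
  by apply: contraTneq Pu => rP0; rewrite -row_free_unit; apply/row_freePn;
     exists i; rewrite rP0 sub0mx.
(* Coordinates of [y] in the orthonormal eigenbasis. *)
pose w := yc *m invmx P.
have wE : w^t* = P *m yc^T.
  rewrite /w (invmx_unitary uP) trmx_mul map_mxM trmxCK; congr (_ *m _).
  by apply/matrixP => i j; rewrite !mxE; apply/CrealP.
have qA : f ((y *m A *m y^T) 0 0) = \sum_j d 0 j * `|w 0 j| ^+ 2.
  transitivity ((w *m diag_mx d *m w^t*) 0 0).
    have -> : w *m diag_mx d *m w^t* = yc *m Ac *m yc^T.
      by rewrite wE /w AP !mulmxA.
    by rewrite map_trmx -!map_mxM [RHS]mxE.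
  rewrite mul_mx_diag mxE; apply: eq_bigr => j _.
  by rewrite [w^t* _ _]mxE [w^T _ _]mxE [X in X * _]mxE normCK mulrAC mulrC.
have q1 : f ((y *m y^T) 0 0) = \sum_j `|w 0 j| ^+ 2.
  transitivity ((w *m w^t*) 0 0).
    by rewrite wE /w -!mulmxA (mulKmx Pu) map_trmx -map_mxM [RHS]mxE.
  by rewrite mxE; apply: eq_bigr => j _; rewrite !mxE normCK.
rewrite -lecR -/f rmorphM/= -/(f _) qA q1 mulr_sumr; apply: ler_sum => j _.
by apply: ler_wpM2r => //; rewrite exprn_ge0.
Qed.

End Rayleigh.

(** * Paths leaving a set, all-ones matrices and cliques *)

Lemma connect_crossing (T : finType) (e : rel T) (P : pred T) x y :
  connect e x y -> P x -> ~~ P y -> exists a b, [/\ e a b, P a & ~~ P b].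
Proof.
case/connectP=> p; elim: p x => [|z p IH] x /=; first by move=> _ -> ->.
case/andP=> exz pz ylast Px nPy.
have [Pz|nPz] := boolP (P z); last by exists x, z.
exact: IH pz ylast Pz nPy.
Qed.

(** Each coordinate satisfies [(b - a) y_j = s], with [s] the sum of all coordinates. For [b != a],
    a zero [s] would force [y = 0]; summing over [j] then gives [b - a = n]. *)
Lemma eigenvalue_scalar_add_const_le (R : realFieldType) n (a b : R) :
  eigenvalue (a%:M + const_mx 1 : 'M_n) b -> b <= a + n%:R.
Proof.
case/eigenvalueP => y yE y0; have [-> | neq_ba] := eqVneq b a.
  by rewrite lerDl ler0n.
have yj j : (b - a) * y 0 j = \sum_i y 0 i.
  have /rowP/(_ j) := yE; rewrite mulmxDr mul_mx_scalar !mxE mulrBl => <-.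
  by rewrite addrAC subrr add0r; apply: eq_bigr => i _; rewrite mxE mulr1.
have sE : (b - a) * \sum_i y 0 i = n%:R * \sum_i y 0 i.
  rewrite mulr_natl -[X in _ *+ X]card_ord -sumr_const mulr_sumr.
  by apply: eq_bigr => j _; exact: yj.
suff s0 : \sum_i y 0 i != 0 by rewrite addrC -lerBlDr (mulIf s0 sE).
apply: contra_neq y0 => s0; apply/rowP => j; apply/eqP; move/eqP: (yj j).
by rewrite s0 mulf_eq0 subr_eq0 (negPf neq_ba) mxE.
Qed.

Lemma eigenvalue_scalar_add_const (R : fieldType) n (a : R) :
  (0 < n)%N -> eigenvalue (a%:M + const_mx 1 : 'M_n) (a + n%:R).
Proof.
move=> n_gt0; apply/eigenvalueP; exists (const_mx 1).
  apply/rowP => j; rewrite mulmxDr mul_mx_scalar !mxE !mulr1; congr (_ + _).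
  by under eq_bigr do rewrite !mxE mulr1; rewrite sumr_const card_ord.
apply/eqP => /rowP/(_ (Ordinal n_gt0))/eqP; rewrite !mxE.
by rewrite oner_eq0.
Qed.

(** Serves to evaluate the rank-one summands of the matrix [B] in [rayleigh_gt_clique]. *)
Lemma quad_outer (R : comPzRingType) n (z u v : 'rV[R]_n) :
  (z *m (u^T *m v) *m z^T) 0 0 = (z *m u^T) 0 0 * (z *m v^T) 0 0.
Proof.
rewrite mulmxA -mulmxA [LHS]mxE big_ord1; congr (_ * _).
by rewrite -[v in LHS]trmxK -trmx_mul mxE.
Qed.

(* Test vector [1_S + e_g / #|S|]: to first order in [1 / #|S|] the edge between
   [f] and [g] raises the Rayleigh quotient above the value [#|S| + a] of
   [1_S]. *)
Lemma rayleigh_gt_clique (R : realFieldType) n (C : 'M[R]_n) (a : R)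
    (S : {set 'I_n}) (f g : 'I_n) :
  (forall i j, 0 <= C i j) -> (forall i, a + 1 <= C i i) ->
  {in S &, forall i j, i != j -> 1 <= C i j} ->
  f \in S -> g \notin S -> 1 <= C f g -> 1 <= C g f ->
  exists z : 'rV[R]_n,
    (#|S|%:R + a) * (z *m z^T) 0 0 < (z *m C *m z^T) 0 0.
Proof.
move=> C0 Cd CS fS gS Cfg Cgf.
have D0 : 0 < #|S|%:R :> R by rewrite ltr0n; apply/card_gt0P; exists f.
pose D : R := #|S|%:R; pose x := D^-1.
have x0 : 0 < x by rewrite invr_gt0.
have Dx : D * x = 1 by rewrite mulfV // gt_eqF.
pose e i : 'rV[R]_n := 'e_i.
pose u : 'rV[R]_n := \row_j (j \in S)%:R; pose z := u + x *: e g.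
have neq_fg : f != g by apply: contraNneq gS => <-.
have zE j : z 0 j = (j \in S)%:R + x * (j == g)%:R by rewrite !mxE eqxx.
have z_ge0 j : 0 <= z 0 j.
  by rewrite zE addr_ge0 ?ler0n // mulr_ge0 ?ler0n // ltW.
have ze i : (z *m (e i)^T) 0 0 = z 0 i by rewrite trmx_delta -colE mxE.
have zf : (z *m (e f)^T) 0 0 = 1.
  by rewrite ze zE fS (negPf neq_fg) mulr0 addr0.
have zg : (z *m (e g)^T) 0 0 = x.
  by rewrite ze zE (negPf gS) eqxx mulr1 add0r.
have zu : (z *m u^T) 0 0 = D.
  rewrite mxE (eq_bigr (fun j => (j \in S)%:R)); last first.
    move=> j _; rewrite zE !mxE; have [->|_] := eqVneq j g.
      by rewrite (negPf gS) mulr0.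
    by rewrite mulr0 addr0 -natrM mulnb andbb.
  rewrite -natr_sum /D -sum1_card [in RHS]big_mkcond /=; congr _%:R.
exists z.
have zz : (z *m z^T) 0 0 = D + x ^+ 2.
  rewrite {2}/z linearD linearZ /= mulmxDr mxE zu -scalemxAr [X in _ + X]mxE.
  by rewrite zg -expr2.
(* An entrywise lower bound for [C]: the clique block on [S], the two entries of the edge between
   [f] and [g], and the 1 missing from the diagonal at [g]. *)
pose B := a%:M + u^T *m u + (e f)^T *m e g + (e g)^T *m e f
  + (e g)^T *m e g : 'M[R]_n.
have zBz : (z *m B *m z^T) 0 0 = a * (D + x ^+ 2) + D ^+ 2 + x + x + x ^+ 2.
  have qD (A A' : 'M_n) : (z *m (A + A') *m z^T) 0 0
      = (z *m A *m z^T) 0 0 + (z *m A' *m z^T) 0 0.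
    by rewrite mulmxDr mulmxDl mxE.
  rewrite /B !qD !quad_outer zu zf zg mul_mx_scalar -scalemxAl.
  by rewrite [(a *: (_ *m _)) 0 0]mxE zz mul1r mulr1 !expr2.
have leBC i j : B i j <= C i j.
  rewrite !mxE !big_ord1 !mxE !eqxx /=.
  have eqgF l : l \in S -> (l == g) = false.
    by move=> lS; apply: contraTF lS => /eqP->.
  have eqfF l : l \notin S -> (l == f) = false.
    by move=> lS; apply: contraNF lS => /eqP->.
  have [<-{j}|neq_ij] := eqVneq i j.
    apply: le_trans (Cd i); case: (boolP (i \in S)) => iS.
      by rewrite (eqgF _ iS) !(mulr0, mul0r) mulr1 !addr0.
    rewrite (eqfF _ iS) !(mulr0, mul0r) !addr0.
    by case: (i == g); rewrite !(mulr0, mulr1) lerD2l ?ler01.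
  rewrite mulr0n add0r.
  case: (boolP (i \in S)) (boolP (j \in S)) => iS [] jS.
  - rewrite (eqgF _ iS) (eqgF _ jS) !(mulr0, mul0r) mulr1 !addr0.
    exact: CS.
  - rewrite (eqgF _ iS) (eqfF _ jS) !(mulr0, mul0r) add0r !addr0.
    by have [->|_] := eqVneq i f; have [->|_] := eqVneq j g;
      rewrite ?(mulr0, mul0r, mulr1).
  - rewrite (eqfF _ iS) (eqgF _ jS) !(mulr0, mul0r) !add0r addr0.
    by have [->|_] := eqVneq i g; have [->|_] := eqVneq j f;
      rewrite ?(mulr0, mul0r, mulr1).
  rewrite (eqfF _ iS) (eqfF _ jS) !(mulr0, mul0r) !add0r.
  have [ig|_] := eqVneq i g; last by rewrite mul0r.
  by rewrite -ig eq_sym (negPf neq_ij) mulr0.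
(* Since [z] is nonnegative, the entrywise bound passes to the quadratic forms. *)
have : (z *m B *m z^T) 0 0 <= (z *m C *m z^T) 0 0.
  rewrite !mxE; apply: ler_sum => j _; rewrite mxE ler_wpM2r ?mxE //.
    by have := z_ge0 j; rewrite !mxE.
  apply: ler_sum => i _; apply: ler_wpM2l; last exact: leBC.
  exact: z_ge0.
apply: lt_le_trans; rewrite zz zBz.
(* With this identity the two sides differ by [x + x ^+ 2], which is positive. *)
have Dxx : D * x ^+ 2 = x by rewrite expr2 mulrA Dx mul1r.
have xx0 : 0 < x ^+ 2 by rewrite exprn_gt0.
rewrite -/D; nra.
Qed.

(** * Ridges shared by facets, and the Gram matrix they form *)

Definition shared_ridges (V : finType) (K : {set {set V}}) (k : nat)
    (F G : {set V}) : nat :=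
  #|[set r in ridges K k | (r \subset F) && (r \subset G)]|.

Lemma card_ridge (V : finType) (K : {set {set V}}) k r :
  (0 < k)%N -> r \in ridges K k -> #|r| = k.
Proof. by move=> hk; rewrite inE prednK // => /andP[_ /eqP]. Qed.

Lemma card_facet (V : finType) (K : {set {set V}}) k F :
  F \in faces K k -> #|F| = k.+1.
Proof. by rewrite inE => /andP[_ /eqP]. Qed.

Lemma facet_setD1_ridge (V : finType) (K : {set {set V}}) k F v :
  simplicial_complex K -> (0 < k)%N ->
  F \in faces K k -> v \in F -> F :\ v \in ridges K k.
Proof.
move=> hK hk; rewrite !inE prednK // => /andP[FK /eqP cF] vF.
by rewrite (hK _ _ FK) ?subD1set //= -eqSS -cF [in X in _ == X](cardsD1 v) vF.
Qed.

(** Deleting a vertex is a bijection from the [k + 1] vertices of [F] to its ridges. *)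
Lemma shared_ridges_diag (V : finType) (K : {set {set V}}) k F :
  simplicial_complex K -> (0 < k)%N ->
  F \in faces K k -> shared_ridges K k F F = k.+1.
Proof.
move=> hK hk FK; rewrite -(card_facet FK) /shared_ridges.
rewrite -(@card_in_imset _ _ (fun v => F :\ v) F) => [|v w vF wF vw].
  apply: eq_card => r; rewrite inE andbb.
  apply/andP/imsetP => [[rK rF]|[v vF ->]].
    exact: card_subset_setD1 (card_ridge hk rK) (card_facet FK) rF.
  by rewrite facet_setD1_ridge // subD1set.
apply/eqP; apply: contraT => nvw.
by have := setD11 v F; rewrite vw in_setD1 vF nvw.
Qed.

(** Distinct facets meet in at most [k] vertices, so a common ridge fills the intersection. *)
Lemma shared_ridge_setI (V : finType) (K : {set {set V}}) k r F G :
  (0 < k)%N -> F \in faces K k -> G \in faces K k -> F != G ->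
  r \in ridges K k -> r \subset F -> r \subset G -> r = F :&: G.
Proof.
move=> hk FK GK FG rK rF rG; apply/eqP; rewrite eqEcard subsetI rF rG /=.
rewrite (card_ridge hk rK) -ltnS -(card_facet FK) proper_card //.
rewrite properEneq subsetIl andbT; apply: contraNneq FG => FIG.
by rewrite eqEcard (card_facet FK) (card_facet GK) leqnn andbT; apply/setIidPl.
Qed.

Lemma shared_ridges_eq1 (V : finType) (K : {set {set V}}) k r F G :
  (0 < k)%N -> F \in faces K k -> G \in faces K k -> F != G ->
  r \in ridges K k -> r \subset F -> r \subset G -> shared_ridges K k F G = 1%N.
Proof.
move=> hk FK GK FG rK rF rG; apply/eqP/cards1P; exists r; apply/setP => s.
rewrite in_set in_set1; apply/andP/eqP => [[sK /andP[sF sG]]|->].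
  rewrite (shared_ridge_setI hk FK GK FG rK rF rG).
  exact: shared_ridge_setI hk FK GK FG sK sF sG.
by rewrite rF rG.
Qed.

Lemma shared_ridges_gt0 (V : finType) (K : {set {set V}}) k r (F G : {set V}) :
  r \in ridges K k -> r \subset F -> r \subset G ->
  (0 < shared_ridges K k F G)%N.
Proof. by move=> rK rF rG; apply/card_gt0P; exists r; rewrite inE rK rF rG. Qed.

(** A facet has a vertex to delete, so ridges exist and the maximum is attained rather than being
    the default 0. *)
Lemma upper_degree_max (V : finType) (K : {set {set V}}) k :
  simplicial_complex K -> (0 < k)%N -> faces K k != set0 ->
  exists2 r, r \in ridges K k &
    max_upper_degree K k = upper_degree K k r /\ (0 < upper_degree K k r)%N.
Proof.
move=> hK hk /set0Pn[F FK].
have /card_gt0P[v vF] : (0 < #|F|)%N by rewrite (card_facet FK).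
have rK := facet_setD1_ridge hK hk FK vF.
have [|r rK' maxE] := @eq_bigmax_cond _ [in ridges K k] (upper_degree K k).
  by apply/card_gt0P; exists (F :\ v).
exists r => //; rewrite /max_upper_degree maxE; split=> //; rewrite -maxE.
apply: leq_trans (leq_bigmax_cond _ rK).
by apply/card_gt0P; exists F; rewrite inE FK subD1set.
Qed.

(* The Laplacian is insensitive to reorienting facets, and for a
   disorientation the products of incidence numbers in the Gram matrix of the
   columns all equal 1. *)
Lemma up_laplacian_gram (R : realType) (V : finType) (K : {set {set V}}) k
    (o : {set V} -> seq V) :
  (0 < k)%N -> orientation_of K o -> disorientable K k o ->
  exists2 N : 'M[R]_(#|ridges K k|, #|faces K k|),
    up_laplacian R K k o = N *m N^T &
    N^T *m N = \matrix_(i, j)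
      (shared_ridges K k (enum_val i) (enum_val j))%:R.
Proof.
move=> hk ho [o' ho' o'E].
have facK F : F \in faces K k -> F \in K by rewrite inE => /andP[].
have ridK r : r \in ridges K k -> r \in K by rewrite inE => /andP[].
pose N : 'M[R]_(#|ridges K k|, #|faces K k|) := \matrix_(i, j)
  (incidence (enum_val i) (enum_val j) (o (enum_val i)) (o' (enum_val j)))%:~R.
exists N.
  apply/matrixP => i i'; rewrite !mxE; apply: eq_bigr => j _; rewrite !mxE.
  set r := enum_val i; set r' := enum_val i'; set F := enum_val j.
  have rK : r \in ridges K k := enum_valP i.
  have r'K : r' \in ridges K k := enum_valP i'.
  have FK : F \in faces K k := enum_valP j.
  have rE s : s \in ridges K k -> incidence s F (o s) (o' F) =
      sgn_reorder (o' F) (o F) * incidence s F (o s) (o F).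
    move=> sK; rewrite (incidence_reorder (card_ridge hk sK) (card_facet FK)
      (ho _ (ridK _ sK)) (ho _ (facK _ FK)) (ho' _ FK)) //.
  (* The reorientation sign depends on the facet alone, so it enters each product squared. *)
  rewrite !rE // -!intrM mulrACA -expr2 sgn_reorder_sqr ?mul1r //.
    by rewrite (perm_uniq (ho' _ FK)) enum_uniq.
  by rewrite (permPl (ho _ (facK _ FK))) perm_sym ho'.
apply/matrixP => i j; rewrite !mxE.
set F := enum_val i; set G := enum_val j.
have FK : F \in faces K k := enum_valP i.
have GK : G \in faces K k := enum_valP j.
transitivity (\sum_(l < #|ridges K k|)
    ((enum_val l \subset F) && (enum_val l \subset G))%:R : R).
  apply: eq_bigr => l _; rewrite !mxE -/F -/G; set r := enum_val l.
  have rK : r \in ridges K k := enum_valP l.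
  have [rF|nrF] := boolP (r \subset F); last first.
    by rewrite (incidence_notsub _ _ nrF) mul0r.
  have [rG|nrG] := boolP (r \subset G); last first.
    by rewrite (incidence_notsub _ _ nrG) mulr0.
  (* For distinct [F] and [G], the ridge [r] itself witnesses adjacency; the product becomes the
     square of a sign. *)
  have -> : incidence r G (o r) (o' G) = incidence r F (o r) (o' F).
    have [<-//|FG] := eqVneq F G; apply/esym/o'E => //.
    by rewrite /facet_adj FK GK FG; apply/exists_inP; exists r; rewrite ?rF.
  rewrite -intrM -expr2.
  by rewrite (incidence_sqr (card_ridge hk rK) (card_facet FK)) ?ho ?ho' ?ridK.
pose inFG (r : {set V}) := (r \subset F) && (r \subset G).
rewrite -(big_enum_val (fun r => (inFG r)%:R)) -natr_sum.
rewrite /shared_ridges -sum1_card; congr _%:R.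
under [RHS]eq_bigl do rewrite in_set.
by rewrite [RHS]big_mkcondr.
Qed.

Theorem corollary4p27 (R : realType) (V : finType) (K : {set {set V}})
    (k : nat) (o : {set V} -> seq V)
    (hK : simplicial_complex K)
    (hk : (1 <= k)%N)
    (hdim : has_dimension K k)
    (ho : orientation_of K o)
    (hconn : facet_graph_connected K k)
    (hdis : disorientable K k o) :
  largest_eigenvalue (up_laplacian R K k o) (max_upper_degree K k + k)%:R <->
  (exists2 r : {set V}, r \in ridges K k &
     forall F : {set V}, F \in faces K k -> r \subset F).
Proof.
have [faces0 _] := hdim.
have [N -> NtN] := up_laplacian_gram R hk ho hdis.
have [r rK [maxE deg_gt0]] := upper_degree_max hK hk faces0.
split=> [[_ leD]|[s sK sF]]; last first.
  have NtNE : N^T *m N = k%:R%:M + const_mx 1.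
    rewrite NtN; apply/matrixP => i j; rewrite !mxE.
    have [<-{j}|ij] := eqVneq i j.
      by rewrite (shared_ridges_diag hK hk) ?enum_valP // -natr1.
    rewrite (shared_ridges_eq1 hk _ _ _ sK) ?sF ?enum_valP //.
      by rewrite add0r.
    by rewrite (inj_eq enum_val_inj).
  have maxF : max_upper_degree K k = #|faces K k|.
    apply/eqP; rewrite eqn_leq; apply/andP; split.
      rewrite maxE; apply: subset_leq_card; apply/subsetP => F.
      by rewrite inE => /andP[].
    apply: leq_trans (leq_bigmax_cond _ sK); apply: subset_leq_card.
    by apply/subsetP => F FK; rewrite inE FK sF.
  have n_gt0 : (0 < #|faces K k|)%N by rewrite card_gt0.
  rewrite maxF addnC natrD; split=> [|b].
    apply: eigenvalue_mulmxC; last first.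
      by rewrite NtNE; exact: eigenvalue_scalar_add_const.
    by rewrite -natrD pnatr_eq0 -lt0n addn_gt0 hk.
  (* Only nonzero eigenvalues transfer between the two products; 0 is bounded directly. *)
  have [-> _|b0] := eqVneq b 0; first by rewrite -natrD ler0n.
  move/(eigenvalue_mulmxC b0); rewrite NtNE.
  exact: eigenvalue_scalar_add_const_le.
have [/forall_inP allr|] := boolP [forall F in faces K k, r \subset F].
  by exists r.
case/forall_inPn => G0 G0K nrG0; exfalso.
have /card_gt0P[F0] := deg_gt0; rewrite inE => /andP[F0K rF0].
pose contains_r (F : {set V}) := r \subset F.
(* A path from a facet containing [r] to one avoiding it has an edge that leaves the clique of
   facets containing [r]. *)
have [F [G [adjFG rF nrG]]] :=
  connect_crossing (P := contains_r) (hconn _ _ F0K G0K) rF0 nrG0.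
have /and4P[FK GK FG /exists_inP[s sK /andP[sF sG]]] := adjFG.
pose S := [set i : 'I_#|faces K k| | r \subset enum_val i].
have cardS : #|S| = max_upper_degree K k.
  rewrite maxE /upper_degree -(card_imset _ enum_val_inj).
  apply: eq_card => H; rewrite inE; apply/imsetP/andP => [[i iS ->]|[HK rH]].
    by move: iS; rewrite inE => ->; rewrite enum_valP.
  by exists (enum_rank_in FK H); rewrite ?inE enum_rankK_in.
(* Here [a] is [k], as the diagonal entries are [k + 1]; the resulting [z] contradicts the Rayleigh
   bound given by [leD]. *)
have [| | | | | | |z] := @rayleigh_gt_clique R _ (N^T *m N) k%:R S
    (enum_rank_in FK F) (enum_rank_in FK G).
- by move=> i j; rewrite NtN mxE ler0n.
- by move=> i; rewrite NtN mxE (shared_ridges_diag hK hk) ?enum_valP // natr1.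
- move=> i j; rewrite !inE => ri rj _; rewrite NtN mxE ler1n.
  exact: shared_ridges_gt0 rK ri rj.
- by rewrite inE enum_rankK_in.
- by rewrite inE enum_rankK_in.
- by rewrite NtN mxE ler1n !enum_rankK_in // (shared_ridges_gt0 sK).
- by rewrite NtN mxE ler1n !enum_rankK_in // (shared_ridges_gt0 sK).
apply/negP; rewrite -leNgt cardS -natrD; apply: rayleigh_le => [|b].
  by rewrite trmx_mul trmxK.
have [-> _|b0] := eqVneq b 0; first by rewrite ler0n.
by move/(eigenvalue_mulmxC b0)/leD.
Qed.
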